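(* For every positive integer $k$ and all sufficiently large $n$ (depending on $k$), $\mu(S_{k,n})\geqslant\mu_a(K_k)+1\geqslant 2^k$.
   Context: Let $G$ be a finite simple graph on the vertex set $\{1,\dots,m\}$ and let $\Gamma$ be a finite set of colors. A strategy for vertex $i$ is a function $F_i:\Gamma^m\to\Gamma$ whose value $F_i(x_1,\dots,x_m)$ depends only on those coordinates $x_j$ for which $j$ is adjacent to $i$ in $G$. For a set $A\subseteq\Gamma^m$ of admissible colorings, a system of strategies $(F_1,\dots,F_m)$ (which may depend on $A$) is winning for $A$ if for every $(x_1,\dots,x_m)\in A$ there is at least one $i$ with $F_i(x_1,\dots,x_m)=x_i$. The hat chromatic number $\mu(G)$ is the largest integer $|\Gamma|$ for which there is a system of strategies winning for $A=\Gamma^m$. The number $\mu_a(G)$ is the largest integer $t$ such that for all $K$, for a color set $\Gamma_K$ of $K$ colors, and for all subsets $A\subseteq\Gamma_K^m$ of cardinality at most $t$, there is a system of strategies winning for $A$. $K_k$ is the complete graph on $k$ vertices. $S_{k,n}$ denotes the $k$-star: the graph obtained by replacing the degree $n$ vertex of the star $K_{1,n}$ by a clique on $k$ vertices, i.e. the graph whose vertex set is a disjoint union $V_1\cup V_2$ with $|V_1|=k$, $|V_2|=n$, $V_1$ inducing a clique, $V_2$ inducing an edgeless graph, and every vertex of $V_1$ adjacent to every vertex of $V_2$. *)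

(* Defs.v *)
From Stdlib Require Import Classical ClassicalEpsilon.
From mathcomp Require Import all_boot.
Set Implicit Arguments.
Unset Strict Implicit.
Unset Printing Implicit Defensive.

Record sgraph := SGraph {
  vertex :> finType;
  adj : rel vertex;
  adj_sym : symmetric adj;
  adj_irr : irreflexive adj }.

Definition coloring (G : sgraph) (C : finType) := {ffun G -> C}.

Definition strategies (G : sgraph) (C : finType) := G -> coloring G C -> C.

Definition admissible (G : sgraph) (C : finType) (F : strategies G C) : Prop :=
  forall (i : G) (x y : coloring G C),
    (forall j : G, adj i j -> x j = y j) -> F i x = F i y.

Definition winning (G : sgraph) (C : finType) (A : {set coloring G C})
    (F : strategies G C) : Prop :=
  forall x, x \in A -> exists i : G, F i x = x i.

Definition winnable (G : sgraph) (C : finType) (A : {set coloring G C}) : Prop :=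
  exists F : strategies G C, admissible F /\ winning A F.

Definition is_largest (P : nat -> Prop) (n : nat) : Prop :=
  P n /\ forall m, P m -> m <= n.

(* Unspecified when there is no largest element; [muP] and [mu_aP] below show
   that this happens neither for [mu] on nonempty graphs nor for [mu_a]. *)
Definition largest (P : nat -> Prop) : nat := epsilon (inhabits 0) (is_largest P).

Definition mu (G : sgraph) : nat :=
  largest (fun q => @winnable G 'I_q [set: coloring G 'I_q]).

Definition mu_a (G : sgraph) : nat :=
  largest (fun t => forall (K : nat) (A : {set coloring G 'I_K}),
    #|A| <= t -> winnable A).

Definition complete_adj (k : nat) : rel 'I_k := fun i j => i != j.

Lemma complete_sym k : symmetric (@complete_adj k).
Proof. by move=> i j; rewrite /complete_adj eq_sym. Qed.

Lemma complete_irr k : irreflexive (@complete_adj k).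
Proof. by move=> i; rewrite /complete_adj eqxx. Qed.

Definition complete_graph (k : nat) : sgraph :=
  SGraph (@complete_sym k) (@complete_irr k).

Definition kstar_adj (k n : nat) : rel ('I_k + 'I_n)%type := fun u v =>
  match u, v with
  | inl i, inl j => i != j
  | inl _, inr _ | inr _, inl _ => true
  | inr _, inr _ => false
  end.

Lemma kstar_sym k n : symmetric (@kstar_adj k n).
Proof. by move=> [i|i] [j|j] //=; rewrite eq_sym. Qed.

Lemma kstar_irr k n : irreflexive (@kstar_adj k n).
Proof. by move=> [i|i] //=; rewrite eqxx. Qed.

Definition kstar (k n : nat) : sgraph :=
  SGraph (@kstar_sym k n) (@kstar_irr k n).

Lemma largestP (P : nat -> Prop) (m b : nat) :
  P m -> (forall n, P n -> n <= b) -> is_largest P (largest P).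
Proof.
move=> Pm Pb; apply: epsilon_spec.
elim: b Pb => [|b IHb] Pb.
  by exists 0; split=> //; have := Pb _ Pm; rewrite leqn0 => /eqP<-.
have [Pb1|nPb1] := classic (P b.+1); first by exists b.+1.
apply: IHb => n Pn; move: (Pb _ Pn); rewrite leq_eqVlt => /orP[/eqP nE|//].
by rewrite nE in Pn.
Qed.

Lemma guess_bound (G : sgraph) (C : finType) (F : strategies G C) (i : G) :
  admissible F ->
  #|C| * #|[set x : coloring G C | F i x == x i]| <= #|C| ^ #|G|.
Proof.
move=> admF; set S := [set x | _].
pose g (p : C * coloring G C) : coloring G C :=
  [ffun j => if j == i then p.1 else p.2 j].
rewrite -card_ffun -cardsT -cardsX.
rewrite -(@card_in_imset _ _ g) ?max_card // => -[c x] [d y].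
rewrite !inE /= => /eqP xS /eqP yS /ffunP gE.
have cE : c = d by have := gE i; rewrite !ffunE eqxx.
have xyE j : j != i -> x j = y j.
  by move=> /negPf ji; have := gE j; rewrite !ffunE ji.
congr pair => //; apply/ffunP => j.
have [->|/xyE //] := eqVneq j i.
rewrite -xS -yS; apply: admF => l il; apply: xyE.
by apply/eqP => lE; rewrite lE adj_irr in il.
Qed.

Lemma winnableT_leq (G : sgraph) (C : finType) :
  0 < #|C| -> winnable [set: coloring G C] -> #|C| <= #|G|.
Proof.
move=> C0 [F [admF winF]].
have cov : [set: coloring G C] \subset
    \bigcup_(i in G) [set x : coloring G C | F i x == x i].
  apply/subsetP => x /winF[i Fi].
  by apply/bigcupP; exists i => //; rewrite inE Fi.
have le1 : #|C| ^ #|G| <= \sum_(i in G) #|[set x : coloring G C | F i x == x i]|.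
  rewrite -card_ffun -cardsT; apply: leq_trans (subset_leq_card cov) _.
  elim/big_rec2: _ => [|i A b _ IH]; first by rewrite cards0.
  by rewrite (leq_trans (leq_card_setU _ _))// leq_add2l.
have CG0 : 0 < #|C| ^ #|G| by rewrite expn_gt0 C0.
rewrite -(leq_pmul2r CG0); apply: leq_trans (leq_mul (leqnn _) le1) _.
rewrite big_distrr /= -sum_nat_const.
by apply: leq_sum => i _; apply: guess_bound.
Qed.

Lemma muP (G : sgraph) : 0 < #|G| ->
  is_largest (fun q => winnable [set: coloring G 'I_q]) (mu G).
Proof.
move=> G0; have [i _] := card_gt0P G0.
apply: (@largestP _ 0 #|G|) => [|[//|q] W].
  have noC (x : coloring G 'I_0) : False by case: (x i).
  by exists (fun _ x => match noC x with end); split=> [? x|x]; case: (noC x).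
by rewrite -[q.+1]card_ord; apply: winnableT_leq => //; rewrite card_ord.
Qed.

Lemma mu_aP (G : sgraph) :
  is_largest (fun t => forall (K : nat) (A : {set coloring G 'I_K}),
    #|A| <= t -> winnable A) (mu_a G).
Proof.
apply: (@largestP _ 0 (#|G|.+1 ^ #|G|)) => [K A|t Wt].
  rewrite leqn0 cards_eq0 => /eqP->.
  case: K A => [|K] A.
    have noC (i : G) (x : coloring G 'I_0) : False by case: (x i).
    by exists (fun i x => match noC i x with end); split=> [i x|x];
      [case: (noC i x)|rewrite inE].
  by exists (fun _ _ => ord0); split=> // x; rewrite inE.
rewrite leqNgt; apply/negP => /ltnW tb.
have := @winnableT_leq G 'I_#|G|.+1; rewrite card_ord ltnn => W.
by apply: notF; apply: W => //; apply: Wt; rewrite cardsT card_ffun card_ord.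
Qed.

(* Main.v *)
(** Lower bound [2 ^ k]: on a complete graph, let one vertex always guess its
    most frequent color in [A]; every other color class contains at most half
    of [A], all remaining vertices know which class they are in, and one can
    iterate.

    Upper bound by [mu]: with [q = mu_a K_k + 1] colors and [n] large, let the
    independent vertices of the star use all functions [f] from clique
    colorings to colors. Once their colors [y_f] are fixed, the set of clique
    colorings [a] with [f a <> y_f] for all [f] has fewer than [q] elements,
    since otherwise some [f] would map it onto all colors; so the clique wins
    on this set. *)
From Stdlib Require Import ClassicalEpsilon.
Require Import Defs.
From mathcomp Require Import all_boot.
Set Implicit Arguments.
Unset Strict Implicit.
Unset Printing Implicit Defensive.

Lemma admissible_exists (G : sgraph) (C : finType) :
  exists F : strategies G C, admissible F.
Proof.
have [c _|C0] := pickP (mem C); first by exists (fun _ _ => c).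
by exists (fun i x => x i) => i x; have := C0 (x i).
Qed.

(** Induction on the list [s] of vertices that may still be needed for a correct guess. The graph
    stays fixed, so no strategy has to be transported from a subgraph. *)
Lemma complete_winning (G : sgraph) (C : finType) :
  (forall i j : G, i != j -> adj i j) ->
  forall (s : seq G) (A : {set coloring G C}), uniq s -> #|A| < 2 ^ size s ->
  exists F : strategies G C, admissible F /\
    forall x, x \in A -> exists2 i, i \in s & F i x = x i.
Proof.
move=> complG; elim=> [|i s IHs] A /=.
  rewrite expn0 ltnS leqn0 cards_eq0 => _ /eqP->.
  by have [F admF] := admissible_exists G C; exists F; split=> // x; rewrite inE.
case/andP=> si us ltA; have [A0|[x0 _]] := set_0Vmem A.
  have [|F [admF _]] := IHs set0 us; first by rewrite cards0 expn_gt0.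
  by exists F; split=> // x; rewrite A0 inE.
pose slice b := [set x in A | x i == b].
case: (@arg_maxnP C (x0 i) xpredT (fun b => #|slice b|)) => // a _ maxa.
(* The slices of [a] and [b] are disjoint and the former is at least as large, so twice the latter
   fits into [A]. *)
have slice_lt b : b != a -> #|slice b| < 2 ^ size s.
  move=> ba; rewrite -(@ltn_pmul2l 2)// -expnS; apply: leq_ltn_trans ltA.
  rewrite mul2n -addnn (leq_trans (leq_add (leqnn _) (maxa b isT)))//.
  rewrite -cardsUI (_ : _ :&: _ = set0) ?cards0 ?addn0.
    by apply: subset_leq_card; apply/subsetP=> x; rewrite !inE -andb_orr => /andP[].
  apply/setP=> x; rewrite !inE; apply/negP => /andP[/andP[_ /eqP xb] /andP[_]].
  by rewrite xb (negPf ba).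
(* The condition [b != a] empties the slice of [a], so the induction hypothesis applies to every
   color [b]. *)
have /choice[f fP] b :
    exists F : strategies G C, admissible F /\
    forall x, x \in [set x in slice b | b != a] -> exists2 l, l \in s & F l x = x l.
  apply: IHs => //; have [->|/[dup] ba /slice_lt] := eqVneq b a.
    by rewrite (_ : [set _ | _] = set0) ?cards0 ?expn_gt0//; apply/setP=> x;
      rewrite !inE andbF.
  by apply: leq_ltn_trans; apply: subset_leq_card; apply/subsetP=> x;
    rewrite inE => /andP[].
exists (fun l (x : coloring G C) => if l == i then a else f (x i) l x); split.
  move=> l x y xy; have [//|li] := eqVneq l i.
  by rewrite (xy _ (complG _ _ li)); apply: (fP (y i)).1.
move=> x xA; have [xa|xa] := eqVneq (x i) a.
  by exists i; rewrite ?mem_head// eqxx.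
have [|l ls Fl] := (fP (x i)).2 x; first by rewrite !inE xA eqxx xa.
exists l; first by rewrite inE ls orbT.
by rewrite ifN//; apply: contraNneq si => <-.
Qed.

Lemma mu_a_complete_ge (k : nat) : 2 ^ k <= mu_a (complete_graph k) + 1.
Proof.
have pos : 0 < 2 ^ k by rewrite expn_gt0.
rewrite addn1 -(prednK pos) ltnS; apply: (mu_aP _).2 => K A leA.
have [||F [admF winF]] := @complete_winning (complete_graph k) 'I_K _
    (enum 'I_k) A (enum_uniq _).
- by [].
- by rewrite size_enum_ord -(prednK pos) ltnS.
by exists F; split=> // x /winF[i _ ?]; exists i.
Qed.

Lemma card_avoid_all_ffun (T C : finType) (y : {ffun T -> C} -> C) :
  0 < #|C| -> #|[set a | [forall f : {ffun T -> C}, f a != y f]]| < #|C|.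
Proof.
move=> /card_gt0P[c0 _]; rewrite ltnNge; apply/negP; set A := [set a | _] => leCA.
(* [f] matches [A] with [C] by position, so the element of [A] at the position of the color [y f] is
   sent to [y f], which membership in [A] forbids. *)
pose f := [ffun a => nth c0 (enum C) (index a (enum A))].
have ltA : index (y f) (enum C) < size (enum A).
  by rewrite -cardE (leq_trans _ leCA)// cardE index_mem mem_enum.
have [a0 _] : exists a0, a0 \in A.
  by apply/card_gt0P; rewrite cardE (leq_ltn_trans _ ltA).
have := mem_nth a0 ltA; rewrite mem_enum inE => /forallP/(_ f)/eqP[].
by rewrite ffunE index_uniq ?enum_uniq// nth_index// mem_enum.
Qed.

Lemma kstar_winnable (k n q : nat) :
  #|{ffun {ffun 'I_k -> 'I_q.+1} -> 'I_q.+1}| <= n ->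
  (forall A : {set coloring (complete_graph k) 'I_q.+1}, #|A| <= q -> winnable A) ->
  winnable [set: coloring (kstar k n) 'I_q.+1].
Proof.
pose T : finType := {ffun 'I_k -> 'I_q.+1}; move=> len winA.
(* Surplus vertices, when [n] exceeds the number of functions, guess [ord0]. *)
pose V2 (v : 'I_n) : {ffun T -> 'I_q.+1} := nth [ffun=> ord0] (enum {ffun T -> 'I_q.+1}) v.
have /choice[vtx vtxK] f : exists j, V2 j = f.
  have lt : index f (enum {ffun T -> 'I_q.+1}) < n.
    by apply: leq_trans len; rewrite cardE index_mem mem_enum.
  by exists (Ordinal lt); rewrite /V2 nth_index ?mem_enum.
pose left_part (x : coloring (kstar k n) 'I_q.+1) : T := [ffun i => x (inl i)].
pose right_part (x : coloring (kstar k n) 'I_q.+1) := [ffun j : 'I_n => x (inr j)].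
pose A (y : {ffun 'I_n -> 'I_q.+1}) := [set a : T | [forall j, V2 j a != y j]].
have /choice[clique cliqueP] y :
    winnable (A y : {set coloring (complete_graph k) _}).
  apply: winA; rewrite -ltnS.
  have := @card_avoid_all_ffun T 'I_q.+1 (fun f => y (vtx f)).
  rewrite card_ord => /(_ isT); apply: leq_ltn_trans.
  apply: subset_leq_card; apply/subsetP=> a; rewrite !inE => /forallP Aa.
  by apply/forallP=> f; have := Aa (vtx f); rewrite vtxK.
exists (fun v x => match v with
  | inl i => clique (right_part x) i (left_part x)
  | inr j => V2 j (left_part x) end); split.
  move=> [i|j] x y xy.
    (* Each clique vertex sees the whole independent side, so the clique strategy may depend on
       it. *)
    have -> : right_part x = right_part y by apply/ffunP=> j; rewrite !ffunE xy.
    by apply: (cliqueP _).1 => j ij; rewrite !ffunE xy.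
  by congr (V2 j _); apply/ffunP=> i; rewrite !ffunE xy.
move=> x _; have [xA|] := boolP (left_part x \in A (right_part x)).
  have [i Fi] := (cliqueP (right_part x)).2 _ xA.
  by exists (inl i); rewrite Fi ffunE.
rewrite inE negb_forall => /existsP[j]; rewrite negbK ffunE => /eqP xj.
by exists (inr j).
Qed.

Theorem theorem13 (k : nat) (k_gt0 : 0 < k) :
  exists N : nat, forall n : nat, N <= n ->
    2 ^ k <= mu_a (complete_graph k) + 1 <= mu (kstar k n).
Proof.
set q := mu_a _.
exists #|{ffun {ffun 'I_k -> 'I_q.+1} -> 'I_q.+1}| => n len.
rewrite mu_a_complete_ge addn1 /=; apply: (muP _).2.
  by apply/card_gt0P; exists (inl (Ordinal k_gt0)).
by apply: kstar_winnable => // A; apply: (mu_aP _).1.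
Qed.
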